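(* Let $n\ge2$, $k\ge1$, $d\ge1$. Then the group $\mathrm{RFA}(\mathbb{Z}^d,n,k)$ of reversible finite-state automata is residually finite and is not finitely generated.
   Context: Let $\Sigma=\{0,\dots,n-1\}$, $Q=\{1,\dots,k\}$. Let $X_k=\{y\in\{0,1,\dots,k\}^{\mathbb{Z}^d} : y_{\vec u}\ne0\text{ and }y_{\vec v}\neq 0\implies \vec u=\vec v\}$ and $X_{n,k}=\Sigma^{\mathbb{Z}^d}\times X_k$. Given finite $F,F'\subset\mathbb{Z}^d$ and $f:\Sigma^F\times Q\to\Sigma^{F'}\times Q\times\mathbb{Z}^d$ (a local rule), the map $T_f:X_{n,k}\to X_{n,k}$ is defined by: $T_f(x,y)=(x,y)$ if $y$ is identically $0$; otherwise let $\vec v$ be the unique position with $q=y_{\vec v}\ne 0$, let $p\in\Sigma^F$ with $p_{\vec u}=x_{\vec v+\vec u}$, and $f(p,q)=(p',q',\vec e)$; then $T_f(x,y)=(\tilde x,\tilde y)$ with $\tilde x_{\vec t}=p'_{\vec t-\vec v}$ if $\vec t-\vec v\in F'$, $\tilde x_{\vec t}=x_{\vec t}$ otherwise, and $\tilde y_{\vec v+\vec e}=q'$, $\tilde y_{\vec t}=0$ for $\vec t\ne\vec v+\vec e$. Such maps are the $(d,n,k)$-Turing machines; one is reversible if it has a two-sided inverse that is a $(d,n,k)$-Turing machine. The reversible ones form the group $\mathrm{RTM}(\mathbb{Z}^d,n,k)$ under composition. $\mathrm{RFA}(\mathbb{Z}^d,n,k)$ is the subgroup of reversible $(d,n,k)$-Turing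 machines that do not change the tape, i.e. that have a local rule $f:\Sigma^F\times Q\to\Sigma^F\times Q\times\mathbb{Z}^d$ of the form $f(p,q)=(p,q',\vec z)$ for all $p\in\Sigma^F,q\in Q$ (with $q',\vec z$ depending on $p,q$). *)

(* Defs.v *)
From HB Require Import structures.
From mathcomp Require Import all_boot all_order all_algebra all_fingroup.
From mathcomp Require Import finmap boolp.
Set Implicit Arguments.
Unset Strict Implicit.
Unset Printing Implicit Defensive.
Import GRing.Theory.

Local Open Scope ring_scope.

Notation Zd d := ('rV[int]_d).

(* Sigma = {0, ..., n-1} is 'I_n, and Q = {1, ..., k} is the set of nonzero
   elements of {0, ..., k} = 'I_k.+1. *)
Definition state (k : nat) : Type := {q : 'I_k.+1 | q != ord0}.

Definition tape (d n : nat) : Type := Zd d -> 'I_n.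

Definition at_most_one_head d k (y : Zd d -> 'I_k.+1) : Prop :=
  forall u v, y u != ord0 -> y v != ord0 -> u = v.

Definition head_conf (d k : nat) : Type :=
  {y : Zd d -> 'I_k.+1 | `[< at_most_one_head y >]}.

Definition config (d n k : nat) : Type := (tape d n * head_conf d k)%type.

Lemma at_most_one_head_single d k (w : Zd d) (q : state k) :
  `[< at_most_one_head (fun t => if t == w then val q else ord0) >].
Proof.
apply/asboolP => u v /=.
by case: (u =P w) => [->|_]; case: (v =P w) => [->|_]; rewrite ?eqxx.
Qed.

Definition head_at d k (w : Zd d) (q : state k) : head_conf d k :=
  exist _ (fun t => if t == w then val q else ord0)
    (at_most_one_head_single w q).

Definition local_rule (d n k : nat) (F F' : {fset Zd d}) : Type :=
  {ffun F -> 'I_n} * state k -> {ffun F' -> 'I_n} * state k * Zd d.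

(* [tm_map f] is T_f. Below, [insub (t - v)] is [Some u], with u the element
   t - v of F', when t - v belongs to F', and [None] otherwise. *)
Definition tm_map d n k (F F' : {fset Zd d}) (f : local_rule n k F F')
    (c : config d n k) : config d n k :=
  let: (x, y) := c in
  match pselect (exists v, val y v != ord0) with
  | left nz =>
      let v := xchoose nz in
      let q : state k := exist _ (val y v) (xchooseP nz) in
      let p := [ffun u : F => x (v + val u)] in
      let: (p', q', e) := f (p, q) in
      ((fun t => if insub (t - v) is Some u then p' u else x t),
       head_at (v + e) q')
  | right _ => (x, y)
  end.

Definition is_turing_machine d n k (T : config d n k -> config d n k) : Prop :=
  exists (F F' : {fset Zd d}) (f : local_rule n k F F'), T = tm_map f.

Definition is_reversible d n k (T : config d n k -> config d n k) : Prop :=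
  is_turing_machine T /\
  exists T', [/\ is_turing_machine T', cancel T T' & cancel T' T].

Record RTM (d n k : nat) := MkRTM {
  rtm_fun :> config d n k -> config d n k;
  rtm_reversible : `[< is_reversible rtm_fun >] }.

HB.instance Definition _ d n k := [isSub of RTM d n k for @rtm_fun d n k].
HB.instance Definition _ d n k := [Choice of RTM d n k by <:].

Definition preserves_tape d n k (F : {fset Zd d}) (f : local_rule n k F F) :=
  forall p q, (f (p, q)).1.1 = p.

Definition is_finite_automaton d n k (T : config d n k -> config d n k) :=
  exists (F : {fset Zd d}) (f : local_rule n k F F),
    preserves_tape f /\ T = tm_map f.

(* A description of Turing machines by maps on whole tapes seen from the head,
   depending on and modifying only the cells of W; it serves to prove that the
   machines, and the automata among them, form groups. *)
Section LocalMaps.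
Context {d n k : nat}.
Implicit Types (T : config d n k -> config d n k) (W E : seq (Zd d)).
Implicit Types (x : tape d n) (q : state k) (v t : Zd d).

Definition local_map T W E (g : tape d n -> state k -> tape d n * state k * Zd d)
  : Prop :=
  [/\ forall x (y : head_conf d k), (forall v, val y v = ord0) ->
        T (x, y) = (x, y),
      forall x v q, let r := g (fun t => x (v + t)) q in
        T (x, head_at v q) = ((fun t => r.1.1 (t - v)), head_at (v + r.2) r.1.2),
      forall x q, (g x q).2 \in E,
      forall x x' q, {in W, x =1 x'} ->
        [/\ (g x q).1.2 = (g x' q).1.2, (g x q).2 = (g x' q).2
          & {in W, (g x q).1.1 =1 (g x' q).1.1}]
    & forall x q t, t \notin W -> (g x q).1.1 t = x t].

Lemma local_map_sub T W W' E g :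
  {subset W <= W'} -> local_map T W E g -> local_map T W' E g.
Proof.
move=> sWW' [T0 Th gE gW gout]; split=> //.
- move=> x x' q xx'; have [|-> -> exx'] := gW x x' q.
    by move=> t /sWW'/xx'.
  split=> // t tW'; have [/exx'//|tW] := boolP (t \in W).
  by rewrite !gout// xx'.
- by move=> x q t tW'; apply: gout; apply: contra tW' => /sWW'.
Qed.

Lemma head_confP (y : head_conf d k) :
  (forall v, val y v = ord0) \/ exists v q, y = head_at v q.
Proof.
have [[v yv]|ny] := pselect (exists v, val y v != ord0).
  right; exists v, (exist _ (val y v) yv); apply/val_inj/funext => t /=.
  case: eqP => [->//|tv]; apply/eqP/negPn/negP => yt.
  by apply: tv; have /asboolP := valP y; apply.
by left=> v; apply/eqP/negPn/negP => yv; apply: ny; exists v.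
Qed.

Lemma head_at_inj v v' q q' : head_at v q = head_at v' q' -> v = v' /\ q = q'.
Proof.
move=> /(congr1 val)/= /funeqP e; have := e v; rewrite eqxx; case: eqP => [vv' qq'|_ q0].
  by split=> //; apply: val_inj.
by have := valP q; rewrite /= q0 eqxx.
Qed.

Lemma tm_map_no_head (F F' : {fset Zd d}) (f : local_rule n k F F') x
    (y : head_conf d k) : (forall v, val y v = ord0) -> tm_map f (x, y) = (x, y).
Proof.
move=> y0; rewrite /tm_map; case: pselect => // nz.
by have [v] := nz; rewrite y0 eqxx.
Qed.

Lemma tm_map_head_at (F F' : {fset Zd d}) (f : local_rule n k F F') x v q :
  let r := f ([ffun u : F => x (v + val u)], q) in
  tm_map f (x, head_at v q) =
  ((fun t => if insub (t - v) is Some u then r.1.1 u else x t),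
   head_at (v + r.2) r.1.2).
Proof.
rewrite /tm_map /=; case: pselect => [nz|[]]; last first.
  by exists v; rewrite /= eqxx; exact: (valP q).
have xv : xchoose nz = v.
  by have := xchooseP nz; rewrite /=; case: (_ =P v); rewrite ?eqxx.
have -> : exist (fun q0 : 'I_k.+1 => q0 != ord0) _ (xchooseP nz) = q.
  by apply: val_inj; rewrite /= xv eqxx.
by rewrite xv; case: f => -[p' q'] e.
Qed.

Definition rule_map (F F' : {fset Zd d}) (f : local_rule n k F F')
    (x : tape d n) (q : state k) : tape d n * state k * Zd d :=
  let r := f ([ffun u : F => x (val u)], q) in
  (fun t => if insub t is Some u then r.1.1 u else x t, r.1.2, r.2).

Lemma local_map_tm (F F' : {fset Zd d}) (f : local_rule n k F F') :
  local_map (tm_map f) (enum_fset F ++ enum_fset F') [seq (f a).2 | a : _]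
    (rule_map f).
Proof.
split.
- exact: tm_map_no_head.
- move=> x v q r; rewrite tm_map_head_at.
  congr (_, _); apply/funext => t; rewrite /r/=.
  by case: insub => [u|]; rewrite ?[v + _]addrC ?subrK.
- by move=> x q; apply: image_f.
- move=> x x' q xx'; rewrite /rule_map.
  have -> : [ffun u : F => x (val u)] = [ffun u => x' (val u)].
    by apply/ffunP => u; rewrite !ffunE xx'// mem_cat (valP u).
  split=> // t tW /=.
  by case: insubP => // _; apply: xx'.
- move=> x q t; rewrite mem_cat negb_or => /andP[_ tF'] /=.
  by case: insubP => // u; rewrite (negPf tF').
Qed.

Lemma local_mapP T : is_turing_machine T <-> exists W E g, local_map T W E g.
Proof.
split=> [[F [F' [f ->]]]|[W [E [g]]]].
  by do 3![eexists]; exact: local_map_tm.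
have sW : {subset W <= 0 :: W} by move=> t tW; rewrite inE tW orbT.
move=> /(local_map_sub sW)[T0 Th _ gW gout].
pose F := seq_fset tt (0 :: W).
have FE t : (t \in F) = (t \in 0 :: W) by rewrite seq_fsetE.
have F0 : 0 \in F by rewrite FE mem_head.
pose ext (p : {ffun F -> 'I_n}) : tape d n :=
  fun t => if insub t is Some u then p u else p [` F0]%fset.
exists F, F, (fun pq => let r := g (ext pq.1) pq.2 in
  ([ffun u => r.1.1 (val u)], r.1.2, r.2)).
apply/funext => -[x y]; have [y0|[v [q ->{y}]]] := head_confP y.
  by rewrite T0// tm_map_no_head.
rewrite Th tm_map_head_at /=.
set p := [ffun u : F => x _].
have [|-> -> exx'] := gW (fun t => x (v + t)) (ext p) q.
  move=> t tW; rewrite /ext; case: insubP => [u _ <-|]; first by rewrite ffunE.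
  by rewrite FE tW.
congr (_, _); apply/funext => t; case: insubP => [u uF ut|tF].
  by rewrite ffunE -ut exx'// -FE (valP u).
by rewrite gout -?FE// addrC subrK.
Qed.

Lemma automatonP T : is_finite_automaton T <->
  exists W E g, local_map T W E g /\ forall x q, (g x q).1.1 = x.
Proof.
split=> [[F [f [fp ->]]]|[W [E [g]]]].
  do 3![eexists]; split; first exact: local_map_tm.
  move=> x q; apply/funext => t /=; rewrite fp.
  by case: insubP => // u _ <-; rewrite ffunE.
have sW : {subset W <= 0 :: W} by move=> t tW; rewrite inE tW orbT.
move=> [/(local_map_sub sW)[T0 Th _ gW gout] gx].
pose F := seq_fset tt (0 :: W).
have FE t : (t \in F) = (t \in 0 :: W) by rewrite seq_fsetE.
have F0 : 0 \in F by rewrite FE mem_head.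
pose ext (p : {ffun F -> 'I_n}) : tape d n :=
  fun t => if insub t is Some u then p u else p [` F0]%fset.
exists F, (fun pq => let r := g (ext pq.1) pq.2 in (pq.1, r.1.2, r.2)).
split=> //; apply/funext => -[x y]; have [y0|[v [q ->{y}]]] := head_confP y.
  by rewrite T0// tm_map_no_head.
rewrite Th tm_map_head_at /=.
set p := [ffun u : F => x _].
have [|-> -> _] := gW (fun t => x (v + t)) (ext p) q.
  move=> t tW; rewrite /ext; case: insubP => [u _ <-|]; first by rewrite ffunE.
  by rewrite FE tW.
congr (_, _); apply/funext => t; rewrite gx addrC subrK.
by case: insubP => // u _ ut; rewrite ffunE ut addrC subrK.
Qed.

Definition comp_map (g1 g2 : tape d n -> state k -> tape d n * state k * Zd d)
    (x : tape d n) (q : state k) : tape d n * state k * Zd d :=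
  let r1 := g1 x q in
  let r2 := g2 (fun t => r1.1.1 (r1.2 + t)) r1.1.2 in
  (fun t => r2.1.1 (t - r1.2), r2.1.2, r1.2 + r2.2).

Lemma local_map_comp T1 T2 W1 W2 E1 E2 g1 g2 :
  local_map T1 W1 E1 g1 -> local_map T2 W2 E2 g2 ->
  local_map (T2 \o T1) (W1 ++ [seq e + w | e <- E1, w <- W2])
    [seq e1 + e2 | e1 <- E1, e2 <- E2] (comp_map g1 g2).
Proof.
set W := _ ++ _ => /(@local_map_sub _ _ W)-/(_ _)/[swap].
have sW1 : {subset W1 <= W} by move=> t; rewrite mem_cat => ->.
have sW2 e w : e \in E1 -> w \in W2 -> e + w \in W.
  by move=> eE wW; rewrite mem_cat allpairs_f// orbT.
move=> L2 /(_ sW1) [T10 T1h gE1 gW1 gout1]; have [T20 T2h gE2 gW2 gout2] := L2.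
split.
- by move=> x y y0; rewrite /= T10// T20.
- move=> x v q /=; rewrite T1h T2h /=.
  set r1 := g1 _ _.
  have -> : (fun t => r1.1.1 (v + r1.2 + t - v)) = (fun t => r1.1.1 (r1.2 + t)).
    by apply/funext => t; rewrite -[v + _ + _]addrA [v + _]addrC addrK.
  by rewrite addrA; congr (_, _); apply/funext => t; rewrite opprD addrA.
- by move=> x q; apply: allpairs_f.
- move=> x x' q xx'; rewrite /comp_map /=.
  have [-> <- x1] := gW1 _ _ q xx'.
  set r1 := g1 x q; set r1' := g1 x' q.
  have [t tW2|-> -> x2] := gW2 (fun t => r1.1.1 (r1.2 + t))
                           (fun t => r1'.1.1 (r1.2 + t)) r1'.1.2.
    by rewrite x1 ?sW2 ?gE1.
  split=> // t tW; have [tW2|tW2] := boolP (t - r1.2 \in W2); first exact: x2.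
  by rewrite !gout2//= addrC subrK x1.
- move=> x q t tW /=; rewrite gout2 1?addrC ?subrK ?gout1//.
  apply: contra tW => tW2; rewrite -[t](subrK (g1 x q).2) addrC sW2 ?gE1 //.
  by rewrite addrC.
Qed.

Definition id_map (x : tape d n) (q : state k) : tape d n * state k * Zd d :=
  (x, q, 0).

Lemma local_map_id : local_map id [::] [:: 0] id_map.
Proof.
split=> //.
- move=> x v q /=; rewrite addr0; congr (_, _); apply/funext => t.
  by rewrite addrC subrK.
- by move=> *; rewrite inE.
Qed.

Lemma is_turing_machine_id : is_turing_machine (@id (config d n k)).
Proof. by apply/local_mapP; do 3![eexists]; exact: local_map_id. Qed.

Lemma is_turing_machine_comp T1 T2 : is_turing_machine T1 ->
  is_turing_machine T2 -> is_turing_machine (T1 \o T2).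
Proof.
move=> /local_mapP[W1 [E1 [g1 L1]]] /local_mapP[W2 [E2 [g2 L2]]].
by apply/local_mapP; do 3![eexists]; exact: local_map_comp L2 L1.
Qed.

Lemma is_finite_automaton_id : is_finite_automaton (@id (config d n k)).
Proof. by apply/automatonP; do 3![eexists]; split; first exact: local_map_id. Qed.

Lemma is_finite_automaton_comp T1 T2 : is_finite_automaton T1 ->
  is_finite_automaton T2 -> is_finite_automaton (T1 \o T2).
Proof.
move=> /automatonP[W1 [E1 [g1 [L1 g1x]]]] /automatonP[W2 [E2 [g2 [L2 g2x]]]].
apply/automatonP; do 3![eexists]; split; first exact: local_map_comp L2 L1.
move=> x q; apply/funext => t /=.
by rewrite g1x g2x /= addrC subrK.
Qed.

Lemma is_finite_automaton_inv T T' : cancel T' T ->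
  is_finite_automaton T -> is_turing_machine T' -> is_finite_automaton T'.
Proof.
move=> T'K /automatonP[W1 [E1 [g1 [[_ Th _ _ _] g1x]]]].
move=> /local_mapP[W [E [g L]]]; apply/automatonP; exists W, E, g; split=> //.
have [_ T'h _ _ _] := L; move=> x q.
have := T'K (x, head_at 0 q); rewrite T'h Th.
have -> : (fun t => x (0 + t)) = x by apply/funext => t; rewrite add0r.
rewrite g1x => -[+ _] => /funeqP xE; apply/funext => t.
by rewrite -[RHS]xE /= subr0 [_ + (t - _)]addrC subrK.
Qed.

End LocalMaps.

(* The group law is composition: (T * U) c = T (U c). *)
Section RTMGroup.
Context {d n k : nat}.
Implicit Types T U : RTM d n k.

Lemma rtm_revP T : is_reversible T. Proof. exact/asboolP/rtm_reversible. Qed.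

Lemma rtm_one_subproof : `[< is_reversible (@id (config d n k)) >].
Proof.
apply/asboolP; split; first exact: is_turing_machine_id.
by exists id; split=> //; exact: is_turing_machine_id.
Qed.

Lemma rtm_mul_subproof T U : `[< is_reversible (T \o U) >].
Proof.
have [TT [T' [TT' TK T'K]]] := rtm_revP T.
have [TU [U' [TU' UK U'K]]] := rtm_revP U.
apply/asboolP; split; first exact: is_turing_machine_comp.
exists (U' \o T'); split; first exact: is_turing_machine_comp.
  exact: can_comp.
exact: can_comp.
Qed.

Definition rtm_inv_fun T := projT1 (cid (rtm_revP T).2).

Lemma rtm_inv_funP T : [/\ is_turing_machine (rtm_inv_fun T),
  cancel T (rtm_inv_fun T) & cancel (rtm_inv_fun T) T].
Proof. exact: projT2 (cid (rtm_revP T).2). Qed.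

Lemma rtm_inv_subproof T : `[< is_reversible (rtm_inv_fun T) >].
Proof.
have [TT' TK T'K] := rtm_inv_funP T.
by apply/asboolP; split=> //; exists T; split=> //; have [] := rtm_revP T.
Qed.

Definition rtm_one : RTM d n k := MkRTM rtm_one_subproof.
Definition rtm_mul T U : RTM d n k := MkRTM (rtm_mul_subproof T U).
Definition rtm_inv T : RTM d n k := MkRTM (rtm_inv_subproof T).

Lemma rtm_mulA : associative rtm_mul. Proof. by move=> T U V; apply: val_inj. Qed.
Lemma rtm_mul1 : left_id rtm_one rtm_mul. Proof. by move=> T; apply: val_inj. Qed.
Lemma rtm_mulr1 : right_id rtm_one rtm_mul.
Proof. by move=> T; apply: val_inj. Qed.
Lemma rtm_mulV : left_inverse rtm_one rtm_inv rtm_mul.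
Proof.
move=> T; apply/val_inj/funext => c.
by have [_ TK _] := rtm_inv_funP T; exact: TK.
Qed.
Lemma rtm_mulVr : right_inverse rtm_one rtm_inv rtm_mul.
Proof.
move=> T; apply/val_inj/funext => c.
by have [_ _ TK] := rtm_inv_funP T; exact: TK.
Qed.

End RTMGroup.

HB.instance Definition _ d n k := isGroup.Build (RTM d n k)
  (@rtm_mulA d n k) (@rtm_mul1 d n k) (@rtm_mulr1 d n k)
  (@rtm_mulV d n k) (@rtm_mulVr d n k).

Definition rfa_pred d n k : {pred RTM d n k} :=
  [pred T : RTM d n k | `[< is_finite_automaton T >]].

Lemma rfa_group_closed d n k : group_closed (@rfa_pred d n k).
Proof.
split=> [|T U]; rewrite !inE.
  by apply/asboolP; exact: is_finite_automaton_id.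
move=> /asboolP TA /asboolP UA; apply/asboolP.
apply: (is_finite_automaton_comp TA).
have [TU' _ UK] := rtm_inv_funP U.
exact: (is_finite_automaton_inv UK UA TU').
Qed.

Record RFA (d n k : nat) := MkRFA {
  rfa_val :> RTM d n k;
  rfa_valP : rfa_val \in @rfa_pred d n k }.

HB.instance Definition _ d n k := [isSub of RFA d n k for @rfa_val d n k].
HB.instance Definition _ d n k := [Choice of RFA d n k by <:].
HB.instance Definition _ d n k :=
  SubChoice_isSubGroup.Build (RTM d n k) (@rfa_pred d n k) (RFA d n k)
    (@rfa_group_closed d n k).

Local Open Scope group_scope.

Definition residually_finite (G : groupType) : Prop :=
  forall g : G, g != 1 ->
    exists (H : finGroupType) (phi : {multiplicative G -> H}), phi g != 1.

(* Some finite list lies in no subgroup of G other than G itself. *)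
Definition finitely_generated (G : groupType) : Prop :=
  exists s : seq G, forall H : {pred G},
    group_closed H -> {subset s <= H} -> forall g, g \in H.

(* Main.v *)
(* On a tape of period N in every direction, an automaton induces a permutation
   of (Z/N)^d x Q, which gives a morphism to a finite group. If T <> 1 moves the
   head on some tape x, it still does so on a tape of large enough period that
   agrees with x on the window of T; hence residual finiteness.
   Let s_N be the sign of this permutation for the tape that is 1 exactly on
   N Z^d, and let T_i be the involution that swaps the positions 0 and e of the
   head, relative to an occurrence of the word 1 0^(i-1) 1 in direction e, in
   one fixed state. That word occurs in the N-th tape only if i = N, and then
   once per period, so that T_i is odd for s_N if and only if i = N. But if
   finitely many elements generated the group, then by the pigeonhole principle
   two of the morphisms s_N would agree on the generators, hence everywhere. *)
Require Import Defs.
From HB Require Import structures.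
From mathcomp Require Import all_boot all_order all_algebra all_fingroup.
From mathcomp Require Import boolp.
Set Implicit Arguments.
Unset Strict Implicit.
Unset Printing Implicit Defensive.
Import GRing.Theory.

(** * Reduction of Z^d modulo N *)

Section Torus.
Local Open Scope ring_scope.
Context {d : nat}.

Definition torus (N : nat) (v : Zd d) : 'rV['Z_N]_d := map_mx intr v.

Lemma torus0 N : torus N 0 = 0.
Proof. exact: map_mx0. Qed.

Lemma torusD N : {morph torus N : u v / u + v}.
Proof. by move=> u v; apply: map_mxD. Qed.

Lemma torusN N : {morph torus N : v / - v}.
Proof. by move=> v; apply: map_mxN. Qed.

Lemma intr_Zp_eq0 (N : nat) (z : int) : (1 < N)%N ->
  (z%:~R == 0 :> 'Z_N) = (N %| `|z|)%N.
Proof.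
move=> N1; have nat_eq0 (m : nat) : (m%:R == 0 :> 'Z_N) = (N %| m)%N.
  by rewrite -val_eqE /= val_Zp_nat.
case: z => m; first by rewrite -pmulrn nat_eq0.
by rewrite NegzE mulrNz oppr_eq0 abszN -pmulrn nat_eq0.
Qed.

Lemma torus_eq0 N (v : Zd d) : (forall i, (`|v 0%R i| < N)%N) ->
  torus N v = 0 -> v = 0.
Proof.
move=> vN v0; apply/rowP => i; have vNi := vN i; apply/eqP.
rewrite mxE -absz_eq0 -leqn0 leqNgt; apply/negP => v_gt0.
have N1 : (1 < N)%N := leq_ltn_trans v_gt0 vNi.
move/rowP/(_ i)/eqP: v0; rewrite !mxE intr_Zp_eq0// => /(dvdn_leq v_gt0).
by rewrite leqNgt vNi.
Qed.

Lemma torus_inj_on (W : seq (Zd d)) : exists N, {in W &, injective (torus N)}.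
Proof.
(* Differences of elements of [W] have coordinates of absolute value at most 2M, so modulo 2M + 1
   only the zero difference vanishes. *)
pose M := \max_(v <- W) \max_i `|v 0%R i|%N; exists (M + M).+1%N => u v uW vW uv.
have boundM w i : w \in W -> (`|w 0%R i| <= M)%N.
  move=> wW; apply: leq_trans (leq_bigmax_seq w wW isT).
  exact: (@leq_bigmax _ (fun i => `|w 0%R i|%N) i).
apply/eqP; rewrite -subr_eq0; apply/eqP; apply: (@torus_eq0 (M + M).+1).
  move=> i; rewrite ltnS !mxE.
  apply: leq_trans (leq_add (boundM u i uW) (boundM v i vW)).
  by have := leqD_dist (u 0 i) 0 (v 0 i); rewrite subr0 sub0r abszN.
by rewrite torusD torusN uv subrr.
Qed.

End Torus.

Lemma shift_tape0 d n (x : tape d n) : (fun t => x (0 + t)%R) = x.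
Proof. by apply/funext => t; rewrite add0r. Qed.

(** * Action of automata on periodic tapes *)

Section Periodic.
Local Open Scope ring_scope.
Context {d n k : nat}.
Implicit Types (T U : RFA d n k) (x : tape d n) (q : state k) (v e : Zd d).

Lemma rfa_moveP T : exists g : tape d n -> state k -> state k * Zd d,
  (forall x v q, let r := g (fun t => x (v + t)) q in
     T (x, head_at v q) = (x, head_at (v + r.2) r.1)) /\
  exists W : seq (Zd d), forall x x' q, {in W, x =1 x'} -> g x q = g x' q.
Proof.
have /asboolP/automatonP[W [E [g [[_ Th _ gW _] gx]]]] := rfa_valP T.
exists (fun x q => ((g x q).1.2, (g x q).2)); split=> [x v q|].
  rewrite Th gx /=; congr (_, _); apply/funext => t.
  by rewrite addrC subrK.
by exists W => x x' q /(gW _ _ q)[-> -> _].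
Qed.

Definition move T := projT1 (cid (rfa_moveP T)).

Lemma moveE T x v q : let r := move T (fun t => x (v + t)) q in
  T (x, head_at v q) = (x, head_at (v + r.2) r.1).
Proof. by have [+ _] := projT2 (cid (rfa_moveP T)); apply. Qed.

Lemma move_local T : exists W : seq (Zd d), forall x x' q,
  {in W, x =1 x'} -> move T x q = move T x' q.
Proof. exact: (projT2 (cid (rfa_moveP T))).2. Qed.

Lemma move_unique T x q q' e :
  T (x, head_at 0 q) = (x, head_at e q') -> move T x q = (q', e).
Proof.
rewrite moveE => /(congr1 snd)/head_at_inj[].
by rewrite shift_tape0 add0r => <- <-; case: move.
Qed.

Lemma move1 x q : move 1%g x q = (q, 0).
Proof. exact: move_unique. Qed.

(** A cocycle rule: [U] acts first, and [T] then reads the tape from where [U] left the head. *)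
Lemma moveM T U x q : move (T * U)%g x q =
  let r := move U x q in let s := move T (fun t => x (r.2 + t)) r.1 in
  (s.1, r.2 + s.2).
Proof.
apply: move_unique; rewrite -[LHS]/(T (U (x, head_at 0 q))) moveE add0r shift_tape0.
by rewrite moveE.
Qed.

Lemma move_id T : (forall x q, move T x q = (q, 0)) -> T = 1%g.
Proof.
move=> T1; apply/val_inj/val_inj/funext => -[x y].
have /asboolP/automatonP[W [E [g [[T0 _ _ _ _] _]]]] := rfa_valP T.
have [y0|[v [q ->]]] := head_confP y; first exact: T0.
by rewrite /= moveE T1 addr0.
Qed.

Context {N : nat}.
Implicit Types (z : 'rV['Z_N]_d -> 'I_n) (a : 'rV['Z_N]_d * state k).

Definition periodic_tape z (b : 'rV['Z_N]_d) : tape d n :=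
  fun t => z (b + torus N t).

(** On a periodic tape the view from the head depends only on the class of its position, so the
    action descends to the torus. *)
Definition torus_step T z a : 'rV['Z_N]_d * state k :=
  let r := move T (periodic_tape z a.1) a.2 in (a.1 + torus N r.2, r.1).

Lemma periodic_tape_shift z b v :
  (fun t => periodic_tape z b (v + t)) = periodic_tape z (b + torus N v).
Proof. by apply/funext => t; rewrite /periodic_tape torusD addrA. Qed.

Lemma torus_step1 z a : torus_step 1%g z a = a.
Proof. by rewrite /torus_step move1 torus0 addr0; case: a. Qed.

Lemma torus_stepM T U z a :
  torus_step (T * U)%g z a = torus_step T z (torus_step U z a).
Proof. by rewrite /torus_step moveM /= periodic_tape_shift torusD addrA. Qed.

Lemma torus_step_inj T z : injective (torus_step T z).
Proof.
apply: (can_inj (g := torus_step T^-1%g z)) => a.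
by rewrite -torus_stepM mulVg torus_step1.
Qed.

(* Permutations compose left to right, machines right to left; hence the
   inverse. *)
Definition torus_perm z T : {perm 'rV['Z_N]_d * state k} :=
  (perm (@torus_step_inj T z))^-1%g.

Lemma torus_permM z : {morph torus_perm z : T U / (T * U)%g}.
Proof.
move=> T U; rewrite /torus_perm -invMg; congr _^-1%g; apply/permP => a.
by rewrite permM !permE torus_stepM.
Qed.

Lemma torus_perm1 z : torus_perm z 1%g = 1%g.
Proof.
rewrite -[RHS]invg1 /torus_perm; congr _^-1%g; apply/permP => a.
by rewrite permE perm1 torus_step1.
Qed.

HB.instance Definition _ z :=
  isUMagmaMorphism.Build (RFA d n k) {perm 'rV['Z_N]_d * state k}
    (torus_perm z) (torus_perm1 z, torus_permM z).

(** Quotients are the form in which [group_closed] asks for closure. *)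
Lemma odd_torus_permB z T U :
  odd_perm (torus_perm z (T * U^-1)%g) =
  odd_perm (torus_perm z T) (+) odd_perm (torus_perm z U).
Proof.
by rewrite gmulfM gmulfV odd_permM [in LHS](odd_permV (torus_perm z U)).
Qed.

End Periodic.

(** * Residual finiteness *)

Lemma rfa_residually_finite d n k : residually_finite (RFA d n k).
Proof.
move=> T T1.
have [x [q moveTq]] : exists x q, move T x q <> (q, 0%R).
  apply: contrapT => fixed; case/eqP: T1; apply: move_id => x q.
  by apply: contrapT => moved; apply: fixed; exists x, q.
have [W moveW] := move_local T.
(* Injectivity on [V] serves twice: [W] can be copied to the torus without conflict, and a nonzero
   displacement stays nonzero there. *)
pose V : seq (Zd d) := [:: 0%R, (move T x q).2 & W].
have [N injN] := torus_inj_on V.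
(* A class that meets [W] gets the letter of its representative in [W]; any other class gets the
   default [x 0]. *)
pose z (b : 'rV['Z_N]_d) := x (head 0%R [seq t <- W | torus N t == b]).
exists {perm 'rV['Z_N]_d * state k}, (torus_perm z).
apply/eqP => phi1; apply: moveTq.
have zx : {in W, periodic_tape z 0 =1 x}.
  move=> t tW; rewrite /periodic_tape /z add0r; congr x.
  have : t \in [seq u <- W | torus N u == torus N t] by rewrite mem_filter eqxx.
  case E : [seq _ <- _ | _] => [//|u r] _ /=.
  have : u \in [seq u <- W | torus N u == torus N t] by rewrite E mem_head.
  by rewrite mem_filter => /andP[/eqP + uW]; apply: injN;
    rewrite !inE ?tW ?uW !orbT.
have : perm (@torus_step_inj _ _ _ _ T z) (0%R, q) = (0%R, q).
  by move/eqP: phi1; rewrite invg_eq1 => /eqP ->; rewrite perm1.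
rewrite permE /torus_step /= (moveW _ _ q zx) add0r => -[].
(* The displacement and 0 have the same class and both lie in [V], so they are equal. *)
rewrite -{1}[0%R](torus0 N) => /injN; rewrite !inE !eqxx ?orbT => /(_ isT isT).
by case: move => ? ? /= -> ->.
Qed.

(** * Automata built from involutive moves *)

Section Construction.
Local Open Scope ring_scope.
Context {d n k : nat}.
Implicit Types (x : tape d n) (q : state k) (v : Zd d).
Implicit Types (m : tape d n -> state k -> state k * Zd d).

Definition automaton_of m (c : config d n k) : config d n k :=
  match pselect (exists vq, c.2 = head_at vq.1 vq.2) with
  | left h =>
      let vq := projT1 (cid h) in
      let r := m (fun t => c.1 (vq.1 + t)) vq.2 in
      (c.1, head_at (vq.1 + r.2) r.1)
  | right _ => c
  end.

Lemma automaton_of_head m x v q : let r := m (fun t => x (v + t)) q in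
  automaton_of m (x, head_at v q) = (x, head_at (v + r.2) r.1).
Proof.
rewrite /automaton_of; case: pselect => [h|[]]; last by exists (v, q).
by case: cid => -[v' q'] /= /head_at_inj[<- <-].
Qed.

Lemma automaton_of_no_head m x (y : head_conf d k) :
  (forall v, val y v = ord0) -> automaton_of m (x, y) = (x, y).
Proof.
move=> y0; rewrite /automaton_of; case: pselect => // h; exfalso.
have [[v q] /= yE] := h; have := y0 v; rewrite yE /= eqxx => q_0.
by have := valP q; rewrite /= q_0 eqxx.
Qed.

Lemma automaton_of_finite m (W E : seq (Zd d)) :
  (forall x x' q, {in W, x =1 x'} -> m x q = m x' q) ->
  (forall x q, (m x q).2 \in E) -> is_finite_automaton (automaton_of m).
Proof.
move=> mW mE; apply/automatonP.
exists W, E, (fun x q => (x, (m x q).1, (m x q).2)); split=> //; split=> //.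
- exact: automaton_of_no_head.
- move=> x v q /=; rewrite automaton_of_head; congr (_, _).
  by apply/funext => t; rewrite addrC subrK.
- by move=> x x' q xx'; rewrite (mW _ _ q xx').
Qed.

(** The last hypothesis says that a second move undoes the first, so the machine is its own
    inverse. *)
Lemma rfa_of_involution m (W E : seq (Zd d)) :
  (forall x x' q, {in W, x =1 x'} -> m x q = m x' q) ->
  (forall x q, (m x q).2 \in E) ->
  (forall x q, m (fun t => x ((m x q).2 + t)) (m x q).1 = (q, - (m x q).2)) ->
  exists T : RFA d n k, forall x q, move T x q = m x q.
Proof.
move=> mW mE mm; have autm := automaton_of_finite mW mE.
have mK : involutive (automaton_of m).
  move=> [x y]; have [y0|[v [q ->]]] := head_confP y.
    by rewrite !automaton_of_no_head.
  rewrite !automaton_of_head.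
  set y' := fun t => x (v + t).
  have -> : (fun t => x (v + (m y' q).2 + t)) = (fun t => y' ((m y' q).2 + t)).
    by apply/funext => t; rewrite /y' addrA.
  by rewrite mm /= addrK.
have tm : is_turing_machine (automaton_of m).
  by have [F [f [_ ->]]] := autm; exists F, F, f.
have rev : `[< is_reversible (automaton_of m) >].
  by apply/asboolP; split=> //; exists (automaton_of m).
have rfa : MkRTM rev \in @rfa_pred d n k by rewrite inE; apply/asboolP.
exists (MkRFA rfa) => x q; rewrite [RHS]surjective_pairing; apply: move_unique.
by rewrite /= automaton_of_head shift_tape0 add0r.
Qed.

End Construction.

(** * Swapping two head positions at each occurrence of a pattern *)

Section Swap.
Local Open Scope ring_scope.
Context {d n k : nat} (e : Zd d) (q0 : state k) (P : pred (tape d n)).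

Definition swap_move (x : tape d n) (q : state k) : state k * Zd d :=
  if (q == q0) && P x then (q, e)
  else if (q == q0) && P (fun t => x (- e + t)) then (q, - e)
  else (q, 0).

(** Since occurrences of [P] never lie [e] apart, the swapped pairs v, v + e are disjoint. The
    window also contains [W] shifted by [- e], where [P] is tested a second time. *)
Lemma rfa_swap (W : seq (Zd d)) :
  (forall x x' : tape d n, {in W, x =1 x'} -> P x = P x') ->
  (forall x, P x -> ~~ P (fun t => x (e + t))) ->
  exists T : RFA d n k, forall x q, move T x q = swap_move x q.
Proof.
move=> PW Pe.
apply: (@rfa_of_involution _ _ _ _ (W ++ [seq - e + t | t <- W]) [:: e; - e; 0]).
- move=> x x' q xx'; rewrite /swap_move (PW x x'); last first.
    by move=> t tW; apply: xx'; rewrite mem_cat tW.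
  rewrite (PW (fun t => x (- e + t)) (fun t => x' (- e + t)))// => t tW.
  by apply: xx'; rewrite mem_cat map_f ?orbT.
- by move=> x q; rewrite /swap_move; case: ifP => _; [|case: ifP => _];
    rewrite !inE eqxx ?orbT.
move=> x q; have shift v : (fun t => x (v + (- v + t))) = x.
  by apply/funext => t; rewrite addrA subrr add0r.
have [/andP[/eqP -> Px]|nPx] := boolP ((q == q0) && P x).
  have -> : swap_move x q0 = (q0, e) by rewrite /swap_move eqxx Px.
  by rewrite /swap_move /= eqxx (negPf (Pe _ Px)) /= shift Px.
have [/andP[/eqP qq0 Px]|nPx'] := boolP ((q == q0) && P (fun t => x (- e + t))).
  have -> : swap_move x q = (q0, - e).
    by move: nPx; rewrite /swap_move qq0 eqxx Px /= => /negPf ->.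
  by rewrite /swap_move /= eqxx Px qq0 opprK.
have xq : swap_move x q = (q, 0) by rewrite /swap_move (negPf nPx) (negPf nPx').
by rewrite xq /= shift_tape0 xq oppr0.
Qed.

Lemma torus_step_swap N (z : 'rV['Z_N]_d -> 'I_n) (T : RFA d n k) b q :
  (forall x q, move T x q = swap_move x q) ->
  torus_step T z (b, q) =
    if (q == q0) && P (periodic_tape z b) then (b + torus N e, q)
    else if (q == q0) && P (periodic_tape z (b - torus N e))
    then (b - torus N e, q) else (b, q).
Proof.
move=> moveT; rewrite /torus_step moveT /swap_move /= periodic_tape_shift torusN.
by do 2!case: ifP => _ //=; rewrite ?torusN// torus0 addr0.
Qed.

End Swap.

(** * The words 1 0^(i-1) 1 and the parity of their swaps *)

Section Gap.
Local Open Scope ring_scope.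
Context {d n k : nat} (i0 : 'I_d) (q0 : state k).
Implicit Types (x : tape d n) (i j N : nat).

Let e : Zd d := delta_mx 0 i0.

(** Any nonzero letter counts as a 1. *)
Definition gap i x : bool :=
  [&& val (x 0) != 0%N, val (x (e *+ i)) != 0%N
    & [forall j : 'I_i, (0 < j)%N ==> (val (x (e *+ j)) == 0%N)]].

(** For i > 1 the letter after the initial 1 is 0, so no occurrence starts at [e]. *)
Lemma rfa_gap i : (1 < i)%N ->
  exists T : RFA d n k, forall x q, move T x q = swap_move e q0 (gap i) x q.
Proof.
move=> i1; apply: (@rfa_swap _ _ _ _ _ _ [seq e *+ j | j <- iota 0 i.+1]).
  move=> x x' xx'; have xE j : (j <= i)%N -> x (e *+ j) = x' (e *+ j).
    by move=> ji; apply: xx'; apply: map_f; rewrite mem_iota ltnS ji.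
  rewrite /gap -(mulr0n e) !xE//; do 2!congr (_ && _).
  by apply: eq_forallb => j; rewrite xE // ltnW.
move=> x /and3P[_ _ /forallP/(_ (Ordinal i1))/= x1].
by rewrite /gap addr0 x1.
Qed.

Lemma torus_mulrn_eq0 N j : (1 < N)%N -> (torus N (e *+ j) == 0) = (N %| j)%N.
Proof.
move=> N1; have -> : (N %| j)%N = (((e *+ j) 0 i0)%:~R == 0 :> 'Z_N).
  by rewrite intr_Zp_eq0 // mulmxnE mxE !eqxx /= (natz j).
apply/eqP/eqP => h; first by have /rowP/(_ i0) := h; rewrite [LHS]mxE [RHS]mxE.
apply/rowP => l; rewrite [LHS]mxE [RHS]mxE.
by have [->|li] := eqVneq l i0; rewrite // mulmxnE mxE (negPf li) andbF mul0rn.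
Qed.

Definition lattice N (o l : 'I_n) (b : 'rV['Z_N]_d) : 'I_n :=
  if b == 0 then l else o.

(** The two ends of the word force b = 0 and N to divide i; if N < i, a lattice point would lie
    among the zeros. *)
Lemma gap_lattice N i (o l : 'I_n) b : (1 < N)%N -> (0 < i)%N ->
  val o = 0%N -> val l != 0%N ->
  gap i (periodic_tape (@lattice N o l) b) = (b == 0) && (i == N).
Proof.
move=> N1 i_gt0 o0 l0.
have zE c : (val (lattice o l c) == 0%N) = (c != 0 :> 'rV['Z_N]_d).
  by rewrite /lattice; have [_|_] := eqVneq c 0; rewrite ?o0 ?(negPf l0).
rewrite /gap /periodic_tape !zE torus0 addr0 !negbK.
have [->|//] := eqVneq b 0; rewrite add0r torus_mulrn_eq0 //=.
apply/andP/eqP => [[dvd /forallP nz]|->]; last first.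
  split=> //; apply/forallP => j; apply/implyP => j_gt0.
  by rewrite zE add0r torus_mulrn_eq0 // gtnNdvd.
apply/eqP; rewrite eqn_leq [X in _ && X]dvdn_leq // andbT leqNgt.
apply/negP => Ni; have := nz (Ordinal Ni).
by rewrite zE add0r torus_mulrn_eq0 //= dvdnn ltnW.
Qed.

(** For i = N the permutation is a single transposition, of two distinct points because N > 1;
    otherwise it is the identity. *)
Lemma odd_gap N i (o l : 'I_n) (T : RFA d n k) : (1 < N)%N -> (1 < i)%N ->
  val o = 0%N -> val l != 0%N ->
  (forall x q, move T x q = swap_move e q0 (gap i) x q) ->
  odd_perm (torus_perm (@lattice N o l) T) = (i == N).
Proof.
move=> N1 i1 o0 l0 moveT; rewrite /torus_perm odd_permV.
have i_gt0 := ltnW i1; have te0 : torus N e != 0.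
  by rewrite -[e]mulr1n torus_mulrn_eq0 // gtnNdvd.
have [iN|iN] := eqVneq i N.
  transitivity (odd_perm (tperm (0 : 'rV['Z_N]_d, q0) (torus N e, q0))).
    congr odd_perm; apply/permP => -[b q]; rewrite permE.
    rewrite (torus_step_swap _ _ _ moveT) !gap_lattice // iN eqxx !andbT.
    case: tpermP => [[-> ->]|[-> ->]|].
    - by rewrite !eqxx add0r.
    - by rewrite eqxx (negPf te0) subrr eqxx.
    move=> b0 be; case: andP => [[/eqP qq /eqP bb]|_].
      by case: b0; rewrite qq bb.
    case: andP => // -[/eqP qq]; rewrite subr_eq0 => /eqP bb.
    by case: be; rewrite qq bb.
  by rewrite odd_tperm xpair_eqE eqxx andbT eq_sym.
rewrite -[RHS](odd_perm1 ('rV['Z_N]_d * state k)%type).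
congr odd_perm; apply/permP => -[b q]; rewrite permE perm1.
by rewrite (torus_step_swap _ _ _ moveT) !gap_lattice // (negPf iN) !andbF.
Qed.

End Gap.

(** * Failure of finite generation *)

Theorem theorem5 (d n k : nat) (hn : 2 <= n) (hk : 1 <= k) (hd : 1 <= d) :
  residually_finite (RFA d n k) /\ ~ finitely_generated (RFA d n k).
Proof.
split; first exact: rfa_residually_finite.
move=> [s gen_s].
(* These are the letters 0 and 1: [hn] unfolds to 1 < n. *)
pose o : 'I_n := Ordinal (ltnW hn); pose l : 'I_n := Ordinal hn.
have q0P : (ord_max : 'I_k.+1) != ord0 by rewrite -val_eqE /= -lt0n.
pose q0 : state k := exist _ ord_max q0P.
pose sgn N (T : RFA d n k) := odd_perm (torus_perm (@lattice d n N o l) T).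
(* There is one more index than sign vectors on [s], so [code] has a collision; the shift by 2 makes
   every modulus exceed 1. *)
pose code (N : 'I_#|{ffun 'I_(size s) -> bool}|.+1) :=
  [ffun j : 'I_(size s) => sgn N.+2 (nth 1%g s j)].
have [N [M NM codeNM]] : exists N, exists2 M, N != M & code N = code M.
  apply: contrapT => inj_code.
  have : injective code.
    move=> N M NM; apply/eqP/negPn/negP => neqNM; apply: inj_code.
    by exists N, M.
  by move/leq_card; rewrite card_ord ltnn.
(* The equalizer of the two colliding sign morphisms. *)
pose H := [pred T | sgn N.+2 T == sgn M.+2 T].
have grpH : group_closed H.
  split=> [|T U]; rewrite !inE /sgn.
    by rewrite !torus_perm1 !odd_perm1.
  by rewrite !odd_torus_permB => /eqP -> /eqP ->.
have sH : {subset s <= H}.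
  move=> T Ts; have iT : index T s < size s by rewrite index_mem.
  have /ffunP/(_ (Ordinal iT)) := codeNM.
  by rewrite !ffunE /= nth_index // inE => ->.
(* This [T] is odd for the modulus N + 2 and even for M + 2, so it lies outside [H]. *)
have [T moveT] := rfa_gap (n := n) (Ordinal hd) q0 (isT : 1 < N.+2).
have := gen_s H grpH sH T; rewrite inE /sgn !(odd_gap _ _ _ _ moveT) //.
by rewrite eqxx !eqSS val_eqE (negPf NM).
Qed.
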